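(* Let $r>0$ and $\sigma_z^2>0$, and let $I$ be a Lognormal--Rician random variable with coherence parameter $r$ and log-variance $\sigma_z^2$. Put $$V_0=\sigma_z^2+\frac{2}{1+r},\qquad \rho=\frac{1}{(1+r)V_0},$$ so that $0<\rho<1/2$. Then, for sufficiently large $r$ and sufficiently small $\sigma_z^2$, the skewness $\gamma_{1,\mathrm{LR}}$ and the excess kurtosis $\gamma_{2,\mathrm{LR}}$ of $I$ satisfy $$\gamma_{1,\mathrm{LR}}=3\sqrt{V_0}\,\left(1-2\rho^2\right)+\mathcal{O}\!\left(V_0^{3/2}\right)$$ and $$\gamma_{2,\mathrm{LR}}=8V_0\left(2-9\rho^2+5\rho^3\right)+\mathcal{O}\!\left(V_0^{2}\right).$$ That is, there exist constants $C,r_0,s_0>0$ such that for all $r\ge r_0$ and $0<\sigma_z^2\le s_0$ the two remainder terms are bounded in absolute value by $CV_0^{3/2}$ and $CV_0^{2}$, respectively.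
   Context: The Lognormal--Rician distribution with coherence parameter $r$ and parameter $\sigma_z^2$ is the distribution on $(0,\infty)$ with density $$f(x;r,\sigma_z^2)=\frac{(1+r)e^{-r}}{\sqrt{2\pi}\,\sigma_z}\int_0^\infty \frac{dz}{z^2}\,I_0\!\left(2\left[\frac{(1+r)r}{z}x\right]^{1/2}\right)\exp\!\left(-\frac{1+r}{z}x-\frac{1}{2\sigma_z^2}\left(\ln z+\tfrac12\sigma_z^2\right)^2\right),$$ where $I_0$ is the zero-order modified Bessel function of the first kind. Equivalently, it is the law of a product $I=ZR$ of independent variables, where $\ln Z$ is Gaussian with mean $-\sigma_z^2/2$ and variance $\sigma_z^2$, and $R$ has density $(1+r)e^{-r-(1+r)x}I_0\big(2\sqrt{r(1+r)x}\big)$ on $(0,\infty)$. Its moments for nonnegative integers $k$ are $$\mathbb{E}[I^k]=\frac{(k!)^2}{(1+r)^k}\exp\!\left[\frac{k(k-1)\sigma_z^2}{2}\right]\sum_{m=0}^{k}\frac{r^m}{(k-m)!\,(m!)^2};$$ in particular $\mathbb{E}[I]=1$. With $\mu$ and $\sigma$ the mean and standard deviation of $I$, the skewness is $\gamma_{1,\mathrm{LR}}=\mathbb{E}[((I-\mu)/\sigma)^3]$ and the excess kurtosis is $\gamma_{2,\mathrm{LR}}=\mathbb{E}[((I-\mu)/\sigma)^4]-3$. The notation $\mathcal{O}(V_0^{p})$ denotes a remainder whose magnitude is bounded by a constant multiple of $V_0^{p}$. *)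

(* Defs.v *)
From HB Require Import structures.
From mathcomp Require Import all_boot all_order all_algebra.
From mathcomp Require Import all_classical all_reals all_analysis.

Set Implicit Arguments.
Unset Strict Implicit.
Unset Printing Implicit Defensive.

Import Order.TTheory GRing.Theory Num.Theory.
Import numFieldNormedType.Exports.

Local Open Scope classical_set_scope.
Local Open Scope ring_scope.

(* The zero-order modified Bessel function of the first kind; the series
   converges for every x. *)
Definition besselI0 (R : realType) (x : R) : R :=
  limn (series (fun k : nat => (x / 2) ^+ (2 * k) / (k`!%:R) ^+ 2)).

(* Here and below v stands for the parameter sigma_z^2, so that
   sigma_z = Num.sqrt v. *)
Definition LR_integrand (R : realType) (r v x z : R) : R :=
  (z ^+ 2)^-1 * besselI0 (2 * Num.sqrt ((1 + r) * r / z * x)) *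
  expR (- ((1 + r) / z * x) - (2 * v)^-1 * (ln z + v / 2) ^+ 2).

(* Extended-real valued, so that finiteness of the inner integral is not
   presupposed. *)
Definition LR_density (R : realType) (r v x : R) : \bar R :=
  (((1 + r) * expR (- r) / (Num.sqrt (2 * pi) * Num.sqrt v))%:E *
   \int[@lebesgue_measure R]_(z in `]0%R, +oo[) (LR_integrand r v x z)%:E)%E.

(* The law of X is carried by (0, +oo) and has density LR_density r v there. *)
Definition is_lognormal_rician (R : realType) (d : measure_display)
    (T : measurableType d) (P : probability T R) (r v : R)
    (X : {RV P >-> R}) : Prop :=
  forall A : set R, measurable A ->
    distribution P X A =
    (\int[@lebesgue_measure R]_(x in A `&` `]0%R, +oo[) LR_density r v x)%E.

Definition mean (R : realType) (d : measure_display) (T : measurableType d)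
    (P : probability T R) (X : T -> R) : R := fine ('E_P[X])%E.

Definition std_dev (R : realType) (d : measure_display) (T : measurableType d)
    (P : probability T R) (X : T -> R) : R := Num.sqrt (fine ('V_P[X])%E).

Definition standardized (R : realType) (d : measure_display)
    (T : measurableType d) (P : probability T R) (X : T -> R) : T -> R :=
  fun w => (X w - mean P X) / std_dev P X.

(* Skewness and excess kurtosis are extended reals: bounding their distance to
   a real number includes the claim that they are finite. *)
Definition skewness (R : realType) (d : measure_display)
    (T : measurableType d) (P : probability T R) (X : T -> R) : \bar R :=
  ('E_P[fun w => ((standardized P X w) ^+ 3)%R])%E.

Definition excess_kurtosis (R : realType) (d : measure_display)
    (T : measurableType d) (P : probability T R) (X : T -> R) : \bar R :=
  ('E_P[fun w => ((standardized P X w) ^+ 4)%R] - 3%:E)%E.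

Definition V0 (R : realType) (r v : R) : R := v + 2 / (1 + r).

Definition rho (R : realType) (r v : R) : R := 1 / ((1 + r) * V0 r v).

(* Main.v *)
Require Import Defs.
From HB Require Import structures.
From mathcomp Require Import all_boot all_order all_algebra.
From mathcomp Require Import all_classical all_reals all_analysis.
From mathcomp Require Import measurable_realfun ring lra.

Set Implicit Arguments.
Unset Strict Implicit.
Unset Printing Implicit Defensive.

Import Order.TTheory GRing.Theory Num.Theory.
Import numFieldNormedType.Exports.

Local Open Scope classical_set_scope.
Local Open Scope ring_scope.

(** Write the law of I as a mixture: given z, the density in x is a power series
in x times an exponential, so its k-th moment is a series of Gamma integrals;
the remaining z-integral is a lognormal moment. With every term nonnegative,
Tonelli's theorem allows the series and both integrals to be taken in any order
([LR_density_moment]), and the resulting series in r is summed by Vandermonde's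
identity ([nneseries_fact_expR]). This gives the closed form [LR_moment] of
E[I^k], in particular E[I] = 1.

Put a = 1/(1+r), w = exp v and V = V0 r v = v + 2 a. Then E[I^2], E[I^3] and
E[I^4] are w, w^3 and w^6 times polynomials in a ([mom2], [mom3], [mom4]), so
the variance and the third and fourth central moments are polynomials in a and
u = w - 1, where u = v + O(V^2). Comparing lowest-degree parts, with
rho = a / V:
- the variance is V + O(V^2);
- the third central moment is 3 V^2 - 6 a^2 + O(V^3), and
  (3 V^2 - 6 a^2) / V^(3/2) = 3 V^(1/2) (1 - 2 rho^2);
- the fourth cumulant is 16 V^3 - 72 V a^2 + 40 a^3 + O(V^4), and dividing the
  leading part by V^2 gives 8 V (2 - 9 rho^2 + 5 rho^3).

Since the variance stays above V/2 ([variance_ge]), replacing it by V in the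
denominators costs no more than the claimed remainders ([ler_div_sqrt3],
[ler_div_sqr]). The bounds hold for r >= 1 and v <= 1/2. *)

(** * Gamma integrals *)

Lemma is_derive_exprM (R : realType) (b : R) (n : nat) (x : R) :
  is_derive x 1 (fun y => (b * y) ^+ n.+1) (n.+1%:R * b * (b * x) ^+ n).
Proof.
have db : is_derive x 1 ( *%R b) b by apply: is_derive_eq; exact: mulr1.
have -> : (fun y => (b * y) ^+ n.+1) = ( *%R b) ^+ n.+1.
  by apply/funext => y; rewrite fctE.
apply: is_derive_eq; rewrite /GRing.scale/= -mulr_natl; ring.
Qed.

(** Differentiating the partial sum of the exponential series drops its last
term, so the product rule telescopes; up to a constant this is a primitive of
x^n exp (- b x). *)
Lemma is_derive_expRM_exp_sum (R : realType) (b : R) (n : nat) (x : R) :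
  is_derive x 1
    (fun y => expR (- b * y) * \sum_(i < n.+1) (b * y) ^+ i / i`!%:R)
    (- b * (expR (- b * x) * ((b * x) ^+ n / n`!%:R))).
Proof.
elim: n => [|n IHn].
  under eq_fun do rewrite big_ord1 expr0 fact0 divr1 mulr1.
  rewrite expr0 fact0 divr1 mulr1.
  by apply: is_derive_eq; rewrite /GRing.scale/=; ring.
under eq_fun do rewrite big_ord_recr/= mulrDr.
have dpow := is_derive_exprM b n x.
have dterm : is_derive x 1 (fun y => expR (- b * y) * ((b * y) ^+ n.+1 / n.+1`!%:R))
    (expR (- b * x) * (b * (b * x) ^+ n / n`!%:R
                       - b * ((b * x) ^+ n.+1 / n.+1`!%:R))).
  apply: is_derive_eq.
  rewrite /GRing.scale/= factS natrM.
  have n0 : n`!%:R != 0 :> R by rewrite pnatr_eq0 -lt0n fact_gt0.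
  by field; rewrite n0/= nat1r pnatr_eq0.
apply: (@is_derive_eq _ _ _ _ _ _ _ _ (is_deriveD IHn dterm)).
by ring.
Qed.

(** The (n+1)-st term of the exponential series bounds x^n exp (- x) by
(n+1)!/x. *)
Lemma cvg_expn_expRN (R : realType) (n : nat) :
  x ^+ n * expR (- x) @[x --> +oo%R] --> (0 : R).
Proof.
apply: (@squeeze_cvgr _ _ _ _ (cst 0) (fun x => n.+1`!%:R * x^-1)).
- near=> x.
  have x0 : 0 < x by near: x; exact: nbhs_pinfty_gt.
  rewrite mulr_ge0 ?exprn_ge0 ?expR_ge0 ?(ltW x0)//=.
  rewrite expRN ler_pdivrMr ?expR_gt0//.
  rewrite mulrAC ler_pdivlMr// -exprSr -ler_pdivrMl ?ltr0n ?fact_gt0// mulrC.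
  by apply: le_trans (expR_ge1Dxn n (ltW x0)); rewrite lerDr.
- exact: cvg_cst.
- rewrite -(mulr0 (n.+1`!%:R : R)); apply: cvgMr.
  by apply/gtr0_cvgV0; [near=> x; near: x; exact: nbhs_pinfty_gt|exact: cvg_id].
Unshelve. all: by end_near. Qed.

Lemma cvg_exp_sum_expRN (R : realType) (c : nat -> R) (n : nat) :
  \sum_(i < n) c i * (x ^+ i * expR (- x)) @[x --> +oo%R] --> (0 : R).
Proof.
elim: n => [|n IHn]; first by under eq_cvg do rewrite big_ord0; exact: cvg_cst.
under eq_cvg do rewrite big_ord_recr/=.
have cvg_n : c n * (x ^+ n * expR (- x)) @[x --> +oo%R] --> c n * 0.
  by apply: cvgMr; exact: cvg_expn_expRN.
rewrite mulr0 in cvg_n.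
by have := cvgD IHn cvg_n; rewrite addr0 => /(_ _); exact.
Qed.

Lemma continuous_expn_expR (R : realType) (b : R) (n : nat) :
  continuous (fun x : R => x ^+ n * expR (- b * x)).
Proof.
move=> x; apply: cvgM; first exact: exprn_continuous.
apply: (@continuous_comp _ _ _ ( *%R (- b)) expR); first exact: mulrl_continuous.
exact: continuous_expR.
Qed.

Lemma integral_expn_expR (R : realType) (b : R) (n : nat) : 0 < b ->
  (\int[@lebesgue_measure R]_(x in `]0%R, +oo[) (x ^+ n * expR (- b * x))%:E =
   (n`!%:R / b ^+ n.+1)%:E)%E.
Proof.
move=> b0.
pose F x := - (n`!%:R / b ^+ n.+1) *
  (expR (- b * x) * \sum_(i < n.+1) (b * x) ^+ i / i`!%:R).
have dF (x : R) : is_derive x 1 F (x ^+ n * expR (- b * x)).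
  have dG := is_derive_expRM_exp_sum b n x.
  rewrite /F; apply: is_derive_eq.
  rewrite /GRing.scale/= exprS exprMn.
  have n0 : n`!%:R != 0 :> R by rewrite pnatr_eq0 -lt0n fact_gt0.
  have bn0 : b ^+ n != 0 by rewrite expf_neq0// gt_eqF.
  by field; rewrite n0 bn0 gt_eqF.
have cf := @continuous_expn_expR R b n.
have cF : continuous F.
  move=> x; apply: differentiable_continuous.
  by apply/derivable1_diffP; exact: ex_derive.
rewrite integral_itv_obnd_cbnd; last first.
  by apply/measurable_EFinP/measurable_funTS; exact: continuous_measurable_fun.
rewrite (@ge0_continuous_FTC2y _ _ F _ 0).
- rewrite /F mulr0 expR0 mul1r big_ord_recl/= big1 ?addr0; last first.
    by move=> i _; rewrite mulr0 expr0n/= mul0r.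
  by rewrite expr0 fact0 divr1 mulr1 -EFinB sub0r opprK.
- by move=> x x0; rewrite mulr_ge0 ?exprn_ge0 ?expR_ge0.
- exact: continuous_subspaceT.
- rewrite -(mulr0 (- (n`!%:R / b ^+ n.+1))).
  apply: cvgMr.
  have -> : (fun x => expR (- b * x) * \sum_(i < n.+1) (b * x) ^+ i / i`!%:R) =
     (fun x => \sum_(i < n.+1) (i`!%:R)^-1 * (x ^+ i * expR (- x))) \o ( *%R b).
    apply/funext => x /=; rewrite mulr_sumr; apply: eq_bigr => i _.
    by rewrite mulNr mulrC mulrAC mulrC.
  apply: (@cvg_comp _ _ _ _ _ _ (pinfty_nbhs R)); first exact: gt0_cvgMry.
  exact: (cvg_exp_sum_expRN (fun i => i`!%:R^-1)).
- by move=> x _; have [] := dF x.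
- by apply: cvg_at_right_filter; exact: cF.
- by move=> x _; rewrite derive1E; have [_ ->] := dF x.
Qed.

(** * Moments of the lognormal kernel *)

(** The substitution y = ln z. Its derivative 1/z blows up at 0, so the change of
variables is made on [1/(n+1), +oo[, and both sides pass to the limit by
monotone convergence over increasing domains. *)
Lemma integral_comp_ln (R : realType) (h : R -> R) : continuous h ->
  (forall x, 0 <= h x) ->
  (\int[@lebesgue_measure R]_(z in `]0%R, +oo[) (h (ln z) / z)%:E =
   \int[@lebesgue_measure R]_x (h x)%:E)%E.
Proof.
move=> ch h0.
pose mu := @lebesgue_measure R.
pose e n : R := n.+1%:R^-1.
have e0 n : 0 < e n by rewrite invr_gt0 ltr0n.
have mh : measurable_fun [set: R] h by exact: continuous_measurable_fun.
have mhln : measurable_fun (`]0%R, +oo[%classic : set R) (fun z => h (ln z) / z).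
  apply: open_continuous_measurable_fun; first exact: interval_open.
  move=> x; rewrite inE/= in_itv/= andbT => x0.
  apply: cvgM; last by apply: inv_continuous; rewrite gt_eqF.
  by apply: continuous_comp; [exact: continuous_ln|exact: ch].
have incrn m n : (m <= n)%N -> e n <= e m.
  by move=> mn; rewrite lef_pV2 ?posrE ?ltr0n// ler_nat.
have ln_cvg : (\int[mu]_(x in `[ln (e n), +oo[) (h x)%:E @[n --> \oo]
      --> \int[mu]_x (h x)%:E)%E.
  rewrite [X in _ --> X](_ : _ =
      \int[mu]_(x in \bigcup_n `[ln (e n), +oo[%classic) (h x)%:E)%E.
    apply: ge0_nondecreasing_set_cvg_integral => //.
    - move=> m n mn; rewrite subsetEset => x/=; rewrite !in_itv/= !andbT.
      by apply: le_trans; rewrite ler_ln ?posrE ?e0 ?incrn.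
    - by move=> n; apply/measurable_EFinP; exact: measurable_funTS.
    - by move=> n x _; rewrite lee_fin.
  congr (integral _ _ _); apply/esym/seteqP; split => // x _.
  exists (Num.truncn (expR (- x))) => //=; rewrite in_itv/= andbT.
  rewrite lnV ?posrE ?ltr0n// lerNl -[leLHS]expRK ler_ln ?posrE ?expR_gt0 ?ltr0n//.
  by apply/ltW/truncnS_gt.
have z_cvg : (\int[mu]_(z in `[e n, +oo[) (h (ln z) / z)%:E @[n --> \oo]
      --> \int[mu]_(z in `]0%R, +oo[) (h (ln z) / z)%:E)%E.
  have -> : `]0%R, +oo[%classic = \bigcup_n `[e n, +oo[%classic.
    apply/seteqP; split => x /=.
      rewrite in_itv/= andbT => x0.
      exists (Num.truncn x^-1) => //=; rewrite in_itv/= andbT.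
      rewrite -[leRHS]invrK lef_pV2 ?posrE ?invr_gt0 ?ltr0n//.
      by apply/ltW/truncnS_gt.
    by move=> [n _]/=; rewrite !in_itv/= !andbT; exact: lt_le_trans.
  apply: ge0_nondecreasing_set_cvg_integral => //.
  - move=> m n mn; rewrite subsetEset => x/=; rewrite !in_itv/= !andbT.
    by apply: le_trans; exact: incrn.
  - move=> n; apply/measurable_EFinP; apply: measurable_funS mhln => //.
    by move=> x/=; rewrite !in_itv/= !andbT; exact: lt_le_trans.
  - move=> n x; rewrite /= in_itv/= andbT lee_fin => nx.
    by rewrite divr_ge0// (le_trans _ nx)// (ltW (e0 n)).
apply: (cvg_unique _ z_cvg) => //.
apply: cvg_trans ln_cvg; apply: near_eq_cvg; near=> n.
rewrite (@increasing_ge0_integration_by_substitutiony _ (@ln R) h (e n))//.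
- apply: eq_integral => z; rewrite inE/= in_itv/= andbT => az.
  congr EFin; rewrite fctE/= derive1E; congr (_ * _).
  by have [_ ->] := is_derive1_ln (lt_le_trans (e0 n) az).
- move=> x y; rewrite !in_itv/= !andbT => ex ey.
  by rewrite ltr_ln ?posrE// (lt_le_trans (e0 n)).
- move=> x; rewrite in_itv/= andbT => ex; have x0 := lt_trans (e0 n) ex.
  apply: (@cvg_trans _ (y^-1 @[y --> x])).
    apply: near_eq_cvg; near=> y.
    rewrite derive1E; apply/esym.
    apply: (@derive_val _ _ _ _ _ _ _ (is_derive1_ln _)).
    by near: y; exact: lt_nbhsr.
  rewrite derive1E.
  have [_ ->] := is_derive1_ln x0.
  by apply: inv_continuous; rewrite gt_eqF.
- apply/cvg_ex; exists (e n)^-1; apply: (@cvg_trans _ (y^-1 @[y --> (e n)^'+])).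
    apply: near_eq_cvg; near=> y.
    rewrite derive1E; apply/esym.
    apply: (@derive_val _ _ _ _ _ _ _ (is_derive1_ln _)).
    by apply: (lt_trans (e0 n)); near: y; exact: nbhs_right_gt.
  by apply: cvg_at_right_filter; apply: inv_continuous; rewrite gt_eqF.
- apply/cvg_ex; exists 0; apply: (@cvg_trans _ (y^-1 @[y --> +oo])).
    apply: near_eq_cvg; near=> y.
    rewrite derive1E; apply/esym.
    apply: (@derive_val _ _ _ _ _ _ _ (is_derive1_ln _)).
    by near: y; exact: nbhs_pinfty_gt.
  by apply/gtr0_cvgV0; [near=> y; near: y; exact: nbhs_pinfty_gt|exact: cvg_id].
- split => [x|].
    rewrite in_itv/= andbT => ex; apply: ex_derive; apply: is_derive1_ln.
    exact: (lt_trans (e0 n)).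
  by apply: cvg_at_right_filter; exact: continuous_ln.
- apply/cvgryPge => A; near=> x.
  rewrite -[leLHS]expRK ler_ln ?posrE ?expR_gt0//.
- exact: continuous_subspaceT.
Unshelve. all: by end_near. Qed.

(** After y = ln z the exponent k y - (y + v/2)^2 / (2 v) is a quadratic;
completing the square leaves the Gaussian density of variance v centred at
(k - 1/2) v and the constant exp (k (k - 1) v / 2). *)
Lemma lognormal_moment (R : realType) (v : R) (k : nat) : 0 < v ->
  (\int[@lebesgue_measure R]_(z in `]0%R, +oo[)
     (z ^+ k / z * expR (- ((2 * v)^-1 * (ln z + v / 2) ^+ 2)))%:E =
   (Num.sqrt (2 * pi) * Num.sqrt v * expR (k%:R * (k%:R - 1) * v / 2))%:E)%E.
Proof.
move=> v0.
have sv0 : Num.sqrt v != 0 by rewrite sqrtr_eq0 -ltNge.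
pose c := Num.sqrt (2 * pi) * Num.sqrt v * expR (k%:R * (k%:R - 1) * v / 2).
pose m := (k%:R - 2^-1) * v.
pose h y := c * normal_pdf m (Num.sqrt v) y.
have c0 : 0 <= c by rewrite !mulr_ge0 ?sqrtr_ge0 ?expR_ge0.
transitivity (\int[@lebesgue_measure R]_(z in `]0%R, +oo[) (h (ln z) / z)%:E)%E.
  apply: eq_integral => z; rewrite inE/= in_itv/= andbT => z0; congr EFin.
  rewrite /h normal_pdfE// /normal_peak /normal_fun sqr_sqrtr ?(ltW v0)//.
  have -> : Num.sqrt (v * pi *+ 2) = Num.sqrt (2 * pi) * Num.sqrt v.
    rewrite -sqrtrM ?mulr_ge0 ?pi_ge0//; congr Num.sqrt.
    by rewrite -mulr_natl; ring.
  have zk : z ^+ k = expR (k%:R * ln z) by rewrite expRM_natl lnK.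
  have s20 : Num.sqrt (2 * pi) != 0 :> R by rewrite sqrtr_eq0 -ltNge mulr_gt0 ?pi_gt0.
  rewrite zk /c.
  set s := Num.sqrt v in sv0 *; set t := Num.sqrt _ in s20 *.
  transitivity (expR (k%:R * (k%:R - 1) * v / 2) *
    expR (- (ln z - m) ^+ 2 / (v *+ 2)) / z); last first.
    by field; rewrite sv0 s20 gt_eqF.
  rewrite mulrAC -!expRD; congr (expR _ / _).
  by rewrite /m -mulr_natl; field; rewrite gt_eqF.
rewrite integral_comp_ln; last 2 first.
- by move=> y; apply: cvgMr; exact: continuous_normal_pdf.
- by move=> y; rewrite mulr_ge0// normal_pdf_ge0.
under eq_integral do rewrite EFinM.
rewrite ge0_integralZl//=; last 2 first.
- by apply/measurable_EFinP; exact: measurable_normal_pdf.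
- by move=> y _; rewrite lee_fin normal_pdf_ge0.
by rewrite integral_normal_pdf mule1.
Qed.

(** * Series *)

Lemma nneseries_expR (R : realType) (r : R) : 0 <= r ->
  (\sum_(j <oo) (r ^+ j / j`!%:R)%:E = (expR r)%:E)%E.
Proof.
move=> r0; rewrite /expR -EFin_lim; last exact: is_cvg_series_exp_coeff.
by apply/congr_lim/funext => n; rewrite /= /series/= sumEFin.
Qed.

(** 'C(j, m) / j! = 1 / (m! (j - m)!), so after a shift by m this is the
exponential series; up to the factor exp r / m! the sum is a factorial moment
of the Poisson law. *)
Lemma nneseries_bin_expR (R : realType) (r : R) (m : nat) : 0 <= r ->
  (\sum_(j <oo) ('C(j, m)%:R * (r ^+ j / j`!%:R))%:E =
   (r ^+ m / m`!%:R * expR r)%:E)%E.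
Proof.
move=> r0.
have term0 j : 0 <= r ^+ j / j`!%:R by rewrite divr_ge0 ?exprn_ge0.
rewrite (@nneseries_split _ _ _ m) => [|j _]; last by rewrite lee_fin mulr_ge0.
rewrite big_nat big1 ?add0e => [|j /=]; last first.
  by rewrite add0n => jm; rewrite bin_small ?mul0r.
rewrite -nneseries_addn => [|j]; last by rewrite lee_fin mulr_ge0.
rewrite EFinM -nneseries_expR// -nneseriesZl => [|j _]; last by rewrite lee_fin.
apply: eq_eseriesr => j _; rewrite -EFinM; congr EFin.
have fact0 n : n`!%:R != 0 :> R by rewrite pnatr_eq0 -lt0n fact_gt0.
have := bin_fact (leq_addl j m); rewrite addnK => <-.
have bin0 : 'C(j + m, m)%:R != 0 :> R by rewrite pnatr_eq0 -lt0n bin_gt0 leq_addl.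
by rewrite add0n exprD !natrM; field; rewrite bin0 !fact0.
Qed.

(** Vandermonde's identity for 'C(j + k, k); it rewrites (k + j)! / j! in the
basis of the 'C(j, m), in which the series over j can be summed. *)
Lemma fact_addn_bin (k j : nat) :
  ((k + j)`! = k`! * j`! * \sum_(m < k.+1) 'C(j, m) * 'C(k, m))%N.
Proof.
rewrite -(bin_fact (leq_addr j k)) addKn mulnC; congr (_ * _)%N.
rewrite addnC -binomial.Vandermonde; apply: eq_bigr => m _.
by rewrite bin_sub// -ltnS.
Qed.

Lemma nneseries_fact_expR (R : realType) (r : R) (k : nat) : 0 <= r ->
  (\sum_(j <oo) ((k + j)`!%:R / j`!%:R ^+ 2 * r ^+ j)%:E =
   (expR r * (k`!%:R * \sum_(m < k.+1) 'C(k, m)%:R * r ^+ m / m`!%:R))%:E)%E.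
Proof.
move=> r0.
have term0 (j : nat) : 0 <= r ^+ j / j`!%:R by rewrite divr_ge0 ?exprn_ge0.
have -> : (expR r * (k`!%:R * \sum_(m < k.+1) 'C(k, m)%:R * r ^+ m / m`!%:R))%:E =
  (\sum_(m < k.+1) \sum_(j <oo)
     (k`!%:R * 'C(k, m)%:R)%:E * ('C(j, m)%:R * (r ^+ j / j`!%:R))%:E)%E.
  rewrite mulrA mulr_sumr -sumEFin; apply: eq_bigr => m _.
  rewrite nneseriesZl => [|j _]; last by rewrite lee_fin mulr_ge0.
  by rewrite nneseries_bin_expR// -EFinM; congr EFin; ring.
rewrite -nneseries_sum => [|m j _]; last first.
  by rewrite -EFinM lee_fin; do 2!apply: mulr_ge0 => //.
apply: eq_eseriesr => j _; rewrite fact_addn_bin.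
under [RHS]eq_bigr do rewrite -EFinM.
rewrite sumEFin; congr EFin.
have fact0 : j`!%:R != 0 :> R by rewrite pnatr_eq0 -lt0n fact_gt0.
rewrite !natrM natr_sum mulr_sumr !mulr_suml; apply: eq_bigr => m _.
by rewrite natrM; field.
Qed.

(** As a real limit, [besselI0] is meaningful only because its series
converges; it does so by comparison with the series of exp y. *)
Lemma besselI0_sqrt (R : realType) (y : R) : 0 <= y ->
  ((besselI0 (2 * Num.sqrt y))%:E = \sum_(j <oo) (y ^+ j / j`!%:R ^+ 2)%:E)%E.
Proof.
move=> y0.
(* the case n = 1 is the dominating exponential series *)
have term0 n (j : nat) : 0 <= y ^+ j / j`!%:R ^+ n by rewrite divr_ge0 ?exprn_ge0.
have -> : besselI0 (2 * Num.sqrt y) = limn (series (fun j => y ^+ j / j`!%:R ^+ 2)).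
  rewrite /besselI0; congr (limn (series _)); apply/funext => j.
  by rewrite mulrAC divff// mul1r exprM sqr_sqrtr.
rewrite -EFin_lim.
  by apply/congr_lim/funext => n; rewrite /= /series/= sumEFin.
apply: (series_le_cvg (term0 2) (term0 1)) (is_cvg_series_exp_coeff y) => j.
rewrite expr1 ler_wpM2l ?exprn_ge0// lef_pV2 ?posrE ?exprn_gt0 ?ltr0n ?fact_gt0//.
by rewrite -natrX ler_nat expnS expn1 leq_pmulr// fact_gt0.
Qed.

(** * Moments of the Lognormal--Rician density *)

Lemma indic_gt0 (R : realType) (x : R) :
  \1_(`]0, +oo[%classic : set R) x = (0 < x)%R%:R :> R.
Proof.
rewrite indicE; congr (nat_of_bool _)%:R.
by apply/idP/idP; rewrite inE/= in_itv/= andbT.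
Qed.

(** The j-th term of the Bessel series inside [LR_integrand], extended by 0
outside the open quadrant so that Tonelli's theorem applies on the whole plane.
The inverse of z is written as a real power, which is a measurable function on
all of R. *)
Definition LR_term (R : realType) (r v : R) (j : nat) (p : R * R) : R :=
  \1_(`]0, +oo[%classic : set R) p.1 * \1_(`]0, +oo[%classic : set R) p.2 *
  (p.2 `^ (-1)) ^+ 2 *
  (((1 + r) * r * p.2 `^ (-1) * p.1) ^+ j / j`!%:R ^+ 2) *
  expR (- ((1 + r) * p.2 `^ (-1) * p.1)) *
  expR (- ((2 * v)^-1 * (ln p.2 + v / 2) ^+ 2)).

(** E[I^k]; since (k!)^2 / ((k - m)! (m!)^2) = k! 'C(k, m) / m!, this is the
usual closed formula for the moments of the Lognormal--Rician law. *)
Definition LR_moment (R : realType) (r v : R) (k : nat) : R :=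
  k`!%:R / (1 + r) ^+ k * expR (k%:R * (k%:R - 1) * v / 2) *
  \sum_(m < k.+1) 'C(k, m)%:R * r ^+ m / m`!%:R.

Section lognormal_rician_moments.
Variables (R : realType) (r v : R).
Hypotheses (r0 : 0 < r) (v0 : 0 < v).
Let mu := @lebesgue_measure R.

Lemma LR_term_ge0 j p : 0 <= LR_term r v j p.
Proof.
rewrite /LR_term !indic_gt0.
have [x0|_] := boolP (0 < p.1); last by rewrite !mul0r.
have y0 : 0 <= (1 + r) * r * p.2 `^ (-1) * p.1.
  by rewrite !mulr_ge0 ?powR_ge0 ?addr_ge0 ?(ltW r0) ?(ltW x0).
by rewrite !mulr_ge0 ?expR_ge0 ?invr_ge0 ?exprn_ge0 ?powR_ge0.
Qed.

Lemma measurable_LR_term j : measurable_fun [set: R * R] (LR_term r v j).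
Proof.
have mpos (f : R * R -> R) : measurable_fun setT f ->
    measurable_fun setT (fun p => \1_(`]0, +oo[%classic : set R) (f p) : R).
  by move=> mf; apply: measurableT_comp mf; exact: measurable_indic.
have m1 : measurable_fun [set: R * R] (fun p => p.1) by exact: measurable_fst.
have m2 : measurable_fun [set: R * R] (fun p => p.2) by exact: measurable_snd.
have mV : measurable_fun [set: R * R] (fun p => p.2 `^ (-1)).
  by apply: (measurableT_comp (measurable_powR _) m2).
rewrite /LR_term; do ![apply: measurable_funM => //].
- exact: mpos.
- exact: mpos.
- apply: measurable_funX.
  by do ![apply: measurable_funM => //].
- apply: measurableT_comp => //; apply: measurableT_comp => //.
  by do ![apply: measurable_funM => //].
- apply: measurableT_comp => //; apply: measurableT_comp => //.
  apply: measurable_funM => //; apply: measurable_funX.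
  apply: measurable_funD => //.
  by apply: (measurableT_comp (@measurable_ln R) m2).
Qed.

Lemma LR_integrand_series x z : 0 < x -> 0 < z ->
  ((LR_integrand r v x z)%:E = \sum_(j <oo) (LR_term r v j (x, z))%:E)%E.
Proof.
move=> x0 z0; rewrite /LR_integrand expRD EFinM EFinM.
have y0 : 0 <= (1 + r) * r / z * x.
  by rewrite !mulr_ge0 ?invr_ge0 ?addr_ge0 ?(ltW r0) ?(ltW x0) ?(ltW z0).
rewrite besselI0_sqrt// muleAC -EFinM -nneseriesZl => [|j _]; last first.
  by rewrite lee_fin divr_ge0 ?exprn_ge0.
apply: eq_eseriesr => j _; rewrite -EFinM /LR_term/= !indic_gt0 x0 z0.
rewrite powR_inv1 ?(ltW z0)// exprVn -[true%:R]/(1 : R) !mul1r; congr EFin; ring.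
Qed.

Lemma measurable_LR_series :
  measurable_fun [set: R * R]
    (fun p => \sum_(j <oo) (LR_term r v j p)%:E)%E.
Proof.
apply: ge0_emeasurable_sum => [j p _ _|j _]; first by rewrite lee_fin LR_term_ge0.
by apply/measurable_EFinP; exact: measurable_LR_term.
Qed.

Lemma LR_density_series x : 0 < x ->
  (LR_density r v x =
   ((1 + r) * expR (- r) / (Num.sqrt (2 * pi) * Num.sqrt v))%:E *
   \int[mu]_z \sum_(j <oo) (LR_term r v j (x, z))%:E)%E.
Proof.
move=> x0; rewrite /LR_density; congr (_ * _)%E.
rewrite integral_mkcond; apply: eq_integral => z _.
rewrite patchE mem_setE in_itv/= andbT; have [z0|z0] := ltP 0 z.
  by rewrite LR_integrand_series.
rewrite eseries0// => j _ _.
by rewrite /LR_term/= !indic_gt0 (ltNge 0 z) z0 mulr0 !mul0r.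
Qed.

Lemma measurable_lognormal_integrand (k : nat) :
  measurable_fun (`]0%R, +oo[%classic : set R)
    (fun z => (z ^+ k / z * expR (- ((2 * v)^-1 * (ln z + v / 2) ^+ 2)))%:E).
Proof.
apply/measurable_EFinP; apply: measurable_funM; first apply: measurable_funM.
- exact: measurable_funX.
- apply: open_continuous_measurable_fun; first exact: interval_open.
  move=> z; rewrite inE/= in_itv/= andbT => z0.
  by apply: inv_continuous; rewrite gt_eqF.
- apply: measurable_funTS; apply: measurableT_comp => //.
  apply: measurableT_comp => //; apply: measurable_funM => //.
  by apply: measurable_funX; apply: measurable_funD => //; exact: measurable_ln.
Qed.

(** For fixed z the x-integral is of Gamma type with rate (1 + r) / z; all powers
of z but z^(k - 1) cancel, which makes the z-dependence the same for every j. *)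
Lemma integral_LR_term (k j : nat) z :
  (\int[mu]_x (`|x| ^+ k * LR_term r v j (x, z))%:E =
   ((k + j)`!%:R / j`!%:R ^+ 2 * r ^+ j / (1 + r) ^+ k.+1)%:E *
   ((fun z => (z ^+ k / z * expR (- ((2 * v)^-1 * (ln z + v / 2) ^+ 2)))%:E)
      \_ `]0%R, +oo[) z)%E.
Proof.
rewrite patchE mem_setE in_itv/= andbT; have [z0|z0] := ltP 0 z; last first.
  rewrite mule0 integral0_eq// => x _; rewrite /LR_term/= !indic_gt0.
  by rewrite (ltNge 0 z) z0 mulr0 !(mul0r, mulr0).
pose b := (1 + r) / z.
have b0 : 0 < b by rewrite divr_gt0// addr_gt0.
transitivity (\int[mu]_(x in `]0%R, +oo[)
  (((r * b) ^+ j / j`!%:R ^+ 2 / z ^+ 2 *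
      expR (- ((2 * v)^-1 * (ln z + v / 2) ^+ 2)))%:E *
   (x ^+ (k + j) * expR (- b * x))%:E))%E.
  rewrite [RHS]integral_mkcond; apply: eq_integral => x _.
  rewrite patchE mem_setE in_itv/= andbT /LR_term/= !indic_gt0.
  have [x0|x0] := ltP 0 x; last by rewrite !(mul0r, mulr0).
  rewrite z0 (gtr0_norm x0) powR_inv1 ?(ltW z0)// -EFinM; congr EFin.
  rewrite -/b mulNr exprD.
  have -> : (1 + r) * r / z * x = r * b * x by rewrite /b; ring.
  rewrite (exprMn j) exprVn -[true%:R]/(1 : R) !mul1r; ring.
have mexp := continuous_measurable_fun (@continuous_expn_expR R b (k + j)).
rewrite ge0_integralZl//=; last 3 first.
- by apply/measurable_EFinP/measurable_funTS.
- move=> x; rewrite in_itv/= andbT => x0.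
  by rewrite lee_fin mulr_ge0 ?exprn_ge0 ?expR_ge0 ?ltW.
- rewrite lee_fin mulr_ge0 ?expR_ge0// !divr_ge0 ?exprn_ge0 ?(ltW z0)//.
  by rewrite mulr_ge0 ?ltW.
rewrite integral_expn_expR// -!EFinM; congr EFin.
rewrite /b -addSn exprD !exprMn !exprVn (exprS z k).
have fact0 : j`!%:R != 0 :> R by rewrite pnatr_eq0 -lt0n fact_gt0.
have z_neq0 : z != 0 by rewrite gt_eqF.
have r1 : 1 + r != 0 by rewrite gt_eqF// addr_gt0.
field.
by rewrite fact0 z_neq0 !(expf_neq0 _ r1) !(expf_neq0 _ z_neq0).
Qed.

Lemma LR_density_patch x :
  ((LR_density r v \_ `]0%R, +oo[) x =
    ((1 + r) * expR (- r) / (Num.sqrt (2 * pi) * Num.sqrt v))%:E *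
    \int[mu]_z \sum_(j <oo) (LR_term r v j (x, z))%:E)%E.
Proof.
rewrite patchE mem_setE in_itv/= andbT.
have [x0|x0] := ltP 0 x; first by rewrite LR_density_series.
rewrite integral0_eq ?mule0// => z _; rewrite eseries0// => j _ _.
by rewrite /LR_term/= !indic_gt0 (ltNge 0 x) x0 !mul0r.
Qed.

Lemma measurable_LR_density :
  measurable_fun [set: R] (LR_density r v \_ `]0%R, +oo[).
Proof.
rewrite (funext LR_density_patch); apply: measurable_funeM.
apply: (@measurable_fun_fubini_tonelli_F _ _ _ _ _ mu
  (fun p => \sum_(j <oo) (LR_term r v j p)%:E)%E).
  exact: measurable_LR_series.
by move=> p; apply: nneseries_ge0 => j _ _; rewrite lee_fin LR_term_ge0.
Qed.

(** All terms are nonnegative, so the double integral of the series becomes the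
series of the double integrals with x integrated first; by [integral_LR_term]
each z-integral is then the same lognormal moment. *)
Lemma LR_density_moment (k : nat) :
  (\int[mu]_x ((`|x| ^+ k)%:E * (LR_density r v \_ `]0%R, +oo[) x) =
   (LR_moment r v k)%:E)%E.
Proof.
pose c := (1 + r) * expR (- r) / (Num.sqrt (2 * pi) * Num.sqrt v).
pose G j (p : R * R) : R := `|p.1| ^+ k * LR_term r v j p.
have G0 j p : 0 <= G j p by rewrite mulr_ge0 ?LR_term_ge0 ?exprn_ge0.
have mG j : measurable_fun [set: R * R] (fun p => (G j p)%:E).
  apply/measurable_EFinP; apply: measurable_funM; last exact: measurable_LR_term.
  by apply: measurable_funX; apply: measurableT_comp => //; exact: measurable_fst.
have mGz x j : measurable_fun [set: R] (fun z => (G j (x, z))%:E).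
  exact: measurableT_comp (mG j) (pair1_measurable _).
have mGx j : measurable_fun [set: R] (fun x => \int[mu]_z (G j (x, z))%:E)%E.
  apply: (@measurable_fun_fubini_tonelli_F _ _ _ _ _ mu (fun p => (G j p)%:E)).
    exact: mG.
  by move=> p; rewrite lee_fin.
have Gx0 j x : (0 <= \int[mu]_z (G j (x, z))%:E)%E.
  by apply: integral_ge0 => z _; rewrite lee_fin.
have c0 : 0 <= c.
  by rewrite divr_ge0 ?mulr_ge0 ?sqrtr_ge0 ?expR_ge0// addr_ge0// ltW.
transitivity (c%:E * \int[mu]_x \sum_(j <oo) \int[mu]_z (G j (x, z))%:E)%E.
  rewrite -ge0_integralZl//; last 2 first.
  - by apply: ge0_emeasurable_sum => [j x _ _|j _]; [exact: Gx0|exact: mGx].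
  - by move=> x _; apply: nneseries_ge0.
  apply: eq_integral => x _.
  rewrite LR_density_patch muleCA; congr (_ * _)%E.
  rewrite -(@integral_nneseries _ _ _ mu setT measurableT
    (fun j z => (G j (x, z))%:E) (mGz x)); last first.
    by move=> j z _; rewrite lee_fin.
  rewrite -ge0_integralZl//; last 2 first.
  - exact: (measurableT_comp measurable_LR_series (pair1_measurable x)).
  - by move=> z _; apply: nneseries_ge0 => j _ _; rewrite lee_fin LR_term_ge0.
  apply: eq_integral => z _.
  rewrite -nneseriesZl => [|j _]; last by rewrite lee_fin LR_term_ge0.
  by apply: eq_eseriesr => j _; rewrite -EFinM.
rewrite (@integral_nneseries _ _ _ mu setT measurableT
  (fun j x => \int[mu]_z (G j (x, z))%:E)%E mGx (fun j x _ => Gx0 j x)).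
pose B := Num.sqrt (2 * pi) * Num.sqrt v * expR (k%:R * (k%:R - 1) * v / 2).
have B0 : 0 <= B by rewrite !mulr_ge0 ?sqrtr_ge0 ?expR_ge0.
have r1 : 0 < 1 + r by rewrite addr_gt0.
have coef0 j : 0 <= (k + j)`!%:R / j`!%:R ^+ 2 * r ^+ j.
  by rewrite mulr_ge0 ?divr_ge0 ?exprn_ge0 ?ltW.
transitivity (c%:E * \sum_(j <oo) (B / (1 + r) ^+ k.+1)%:E *
    ((k + j)`!%:R / j`!%:R ^+ 2 * r ^+ j)%:E)%E.
  congr (_ * _)%E; apply: eq_eseriesr => j _.
  have Gj0 p : (0 <= (G j p)%:E)%E by rewrite lee_fin.
  transitivity (\int[mu]_z \int[mu]_x (G j (x, z))%:E)%E.
    exact: (@fubini_tonelli _ _ _ _ _ (@lebesgue_measure R) (@lebesgue_measure R)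
      (fun p => (G j p)%:E) (mG j) Gj0).
  under eq_integral do rewrite integral_LR_term.
  rewrite ge0_integralZl//; last 3 first.
  - by apply/(measurable_restrictT _ _).1 => //; exact: measurable_lognormal_integrand.
  - move=> z _; rewrite patchE mem_setE in_itv/= andbT; case: ifPn => // z0.
    rewrite lee_fin; apply: mulr_ge0 (expR_ge0 _).
    by apply: divr_ge0; [exact/exprn_ge0/ltW|exact: ltW].
  - by rewrite lee_fin; apply: divr_ge0; [exact: coef0|exact/exprn_ge0/ltW].
  rewrite -integral_mkcond lognormal_moment// -!EFinM; congr EFin.
  by rewrite /B; ring.
rewrite nneseriesZl//; last by move=> j _; rewrite lee_fin.
rewrite nneseries_fact_expR ?(ltW r0)// -!EFinM; congr EFin.
rewrite /LR_moment /c /B expRN exprS.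
have s1 : Num.sqrt v != 0 by rewrite sqrtr_eq0 -ltNge.
have s2 : Num.sqrt (2 * pi) != 0 :> R.
  by rewrite sqrtr_eq0 -ltNge mulr_gt0 ?pi_gt0.
set S := \sum_(_ < _) _.
field.
by rewrite (expf_neq0 _ (lt0r_neq0 r1)) (lt0r_neq0 r1) s1 s2 gt_eqF ?expR_gt0.
Qed.
End lognormal_rician_moments.

(** * From the density to the random variable *)

(** nu is absolutely continuous because f integrates to 0 over null sets, and f
agrees almost everywhere with the Radon--Nikodym derivative because both
integrate to nu over every measurable set. *)
Lemma integral_density (d : measure_display) (T : measurableType d)
    (R : realType) (nu : {finite_measure set T -> \bar R})
    (mu : {sigma_finite_measure set T -> \bar R}) (f g : T -> \bar R) :
  measurable_fun [set: T] f -> measurable_fun [set: T] g ->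
  (forall x, 0 <= g x)%E ->
  (forall A, measurable A -> nu A = \int[mu]_(x in A) f x)%E ->
  (\int[nu]_x g x = \int[mu]_x (g x * f x))%E.
Proof.
move=> mf mg g0 nuf.
have numu : nu `<< mu.
  apply/null_content_dominatesP => A mA muA0; rewrite nuf//.
  by apply: null_set_integral => //; exact: measurable_funTS.
pose h := Radon_Nikodym_SigmaFinite.f nu mu.
have hint : mu.-integrable setT h by exact: Radon_Nikodym_SigmaFinite.f_integrable.
have hf : ae_eq mu setT h f.
  apply: integral_ae_eq => // A _ mA.
  by rewrite -nuf// -Radon_Nikodym_SigmaFinite.f_integral.
rewrite -(Radon_Nikodym_SigmaFinite.change_of_variables numu)//.
apply: ae_eq_integral => //.
- by apply: emeasurable_funM => //; exact: measurable_int hint.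
- exact: emeasurable_funM.
- by apply: ae_eqe_mul2l.
Qed.

Lemma integral_comp_density (R : realType) (d : measure_display)
    (T : measurableType d) (P : probability T R) (X : {RV P >-> R})
    (f g : R -> \bar R) :
  measurable_fun [set: R] f -> measurable_fun [set: R] g ->
  (forall x, 0 <= g x)%E ->
  (forall A, measurable A ->
     distribution P X A = \int[@lebesgue_measure R]_(x in A) f x)%E ->
  (\int[P]_w g (X w) = \int[@lebesgue_measure R]_x (g x * f x))%E.
Proof.
move=> mf mg g0 Xf.
have mX : measurable_fun [set: T] X by exact: measurable_funP.
(* The law of X lives on the Borel structure of R, Lebesgue measure on the
   generated sigma-algebra: the measurable sets are the same but the two types
   differ, so X is repackaged with values in the latter. *)
have mY : @measurable_fun _ _ T (measurableTypeR R) setT X.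
  by move=> _ A mA; exact: mX.
pose Y : {RV P >-> measurableTypeR R} :=
  HB.pack_for {RV P >-> measurableTypeR R} (X : T -> measurableTypeR R)
    (@isMeasurableFun.Build _ _ T (measurableTypeR R) X mY).
rewrite -(@ge0_integral_distribution _ _ _ _ _ P Y g)//.
exact: (@integral_density _ (measurableTypeR R) R (distribution P Y)
  (@lebesgue_measure R) f g mf mg g0 Xf).
Qed.

(** The density gives the moments of |X|, hence integrability; they are the
moments of X because the law gives no mass to ]-oo, 0]. *)
Lemma LR_raw_moment (R : realType) (d : measure_display)
    (T : measurableType d) (P : probability T R) (X : {RV P >-> R})
    (r v : R) (k : nat) : 0 < r -> 0 < v -> is_lognormal_rician r v X ->
  (fun w => X w ^+ k) \in Lfun P 1 /\
  ('E_P[(fun w => (X w ^+ k)%R)] = (LR_moment r v k)%:E)%E.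
Proof.
move=> r0 v0 XLR.
have mX : measurable_fun [set: T] X by exact: measurable_funP.
have mXk : measurable_fun [set: T] (fun w => (X w ^+ k)%:E).
  by apply/measurable_EFinP; exact: measurable_funX.
have mXak : measurable_fun [set: T] (fun w => (`|X w| ^+ k)%:E).
  by apply/measurable_EFinP; apply: measurable_funX; exact: measurableT_comp.
have EX : (\int[P]_w (`|X w| ^+ k)%:E = (LR_moment r v k)%:E)%E.
  rewrite -(LR_density_moment r0 v0).
  apply: (@integral_comp_density _ _ _ _ X _ (fun x => (`|x| ^+ k)%:E)).
  - exact: measurable_LR_density.
  - by apply/measurable_EFinP; apply: measurable_funX; exact: normr_measurable.
  - by move=> x; rewrite lee_fin exprn_ge0.
  - by move=> A mA; rewrite XLR// integral_mkcondr.
split.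
  apply/Lfun1_integrable; apply/integrableP; split => //.
  by under eq_integral do rewrite /= normrX; rewrite EX ltry.
rewrite unlock -EX; apply: ae_eq_integral => //.
exists (X @^-1` `]-oo, 0]); split.
- by rewrite -[X @^-1` _]setTI; exact: mX.
- transitivity (distribution P X `]-oo, 0]) => //.
  rewrite XLR// (_ : _ `&` _ = set0) ?integral_set0//.
  by apply/seteqP; split => // x [] /=; rewrite !in_itv/= andbT leNgt => /negP.
- move=> w /=; rewrite in_itv/= => Xw; rewrite leNgt; apply/negP => Xw0.
  by apply: Xw => _; rewrite gtr0_norm.
Qed.

Lemma expectation_lincomb_expn (R : realType) (d : measure_display)
    (T : measurableType d) (P : probability T R) (X : T -> R) (M : nat -> R)
    (c : nat -> R) (n : nat) :
  (forall k, (fun w => X w ^+ k) \in Lfun P 1 /\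
     ('E_P[(fun w => (X w ^+ k)%R)] = (M k)%:E)%E) ->
  (fun w => \sum_(i < n) c i * X w ^+ i) \in Lfun P 1 /\
  ('E_P[(fun w => (\sum_(i < n) c i * X w ^+ i)%R)] =
   (\sum_(i < n) c i * M i)%:E)%E.
Proof.
move=> XM; elim: n => [|n [Ln En]].
  have -> : (fun w => \sum_(i < 0) c i * X w ^+ i) = cst 0.
    by apply/funext => w; rewrite big_ord0.
  by rewrite big_ord0 expectation_cst; split=> //; exact: Lfun_cst.
have [LX EX] := XM n.
have -> : (fun w => \sum_(i < n.+1) c i * X w ^+ i) =
    (fun w => \sum_(i < n) c i * X w ^+ i) \+ (c n \o* (fun w => X w ^+ n)).
  by apply/funext => w; rewrite big_ord_recr/= (mulrC (c n)).
have LcX : c n \o* (fun w => X w ^+ n) \in Lfun P 1 by exact: Lfun_scale.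
split; first by rewrite rpredD.
by rewrite expectationD// En expectationZl// EX -EFinM -EFinD big_ord_recr.
Qed.

(** * Expansion of the variance and cumulants *)

Section order_of_magnitude.
Variable R : realType.
Implicit Types (f g : R -> R -> R) (a v : R) (m n : nat).

(** O(V^n) for V = v + 2 a, uniformly on the region 0 < a <= 1, 0 < v <= 1/2.
With a = 1 / (1 + r), the bound a <= 1 reads r >= 0 and V is V0 r v. *)
Definition isO n f := exists2 K, 0 <= K & forall a v,
  0 < a -> a <= 1 -> 0 < v -> v <= 1 / 2 -> `|f a v| <= K * (v + 2 * a) ^+ n.

Lemma isO_cst (c : R) : isO 0 (fun a v => c).
Proof. by exists `|c| => // a v *; rewrite expr0 mulr1. Qed.

Lemma isO_fst : isO 1 (fun a v => a).
Proof.
exists 1 => // a v a0 _ v0 _; rewrite gtr0_norm// mul1r expr1; lra.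
Qed.

Lemma isO_snd : isO 1 (fun a v => v).
Proof.
exists 1 => // a v a0 _ v0 _; rewrite gtr0_norm// mul1r expr1; lra.
Qed.

Lemma isOD n f g : isO n f -> isO n g -> isO n (fun a v => f a v + g a v).
Proof.
move=> [K K0 fK] [L L0 gL]; exists (K + L); first exact: addr_ge0.
move=> a v a0 a1 v0 v1; rewrite mulrDl (le_trans (ler_normD _ _))//.
by rewrite lerD ?fK ?gL.
Qed.

Lemma isON n f : isO n f -> isO n (fun a v => - f a v).
Proof.
by move=> [K K0 fK]; exists K => // a v a0 a1 v0 v1; rewrite normrN fK.
Qed.

Lemma isOM m n f g : isO m f -> isO n g -> isO (m + n) (fun a v => f a v * g a v).
Proof.
move=> [K K0 fK] [L L0 gL]; exists (K * L); first exact: mulr_ge0.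
move=> a v a0 a1 v0 v1; rewrite normrM exprD mulrACA.
by rewrite ler_pM ?fK ?gL.
Qed.

Lemma isOX m n f : isO m f -> isO (n * m) (fun a v => f a v ^+ n).
Proof.
move=> Of; elim: n => [|n IHn]; first exact: (isO_cst 1).
have -> : (fun a v => f a v ^+ n.+1) = (fun a v => f a v * f a v ^+ n).
  by apply/funext => a; apply/funext => v; rewrite exprS.
by rewrite mulSn; exact: isOM.
Qed.

(** V <= 3 on the region. *)
Lemma isO_weaken m n f : isO (m + n) f -> isO m f.
Proof.
move=> [K K0 fK]; exists (K * 3 ^+ n); first by rewrite mulr_ge0 ?exprn_ge0.
move=> a v a0 a1 v0 v1; rewrite (le_trans (fK _ _ _ _ _ _))//.
have V0 : 0 <= v + 2 * a by lra.
rewrite exprD mulrA mulrAC ler_wpM2r ?exprn_ge0// ler_wpM2l//.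
by rewrite lerXn2r ?nnegrE//; lra.
Qed.

(** exp (- v) >= 1 - v gives (exp v - 1 - v) (1 - v) <= v^2, and 1 - v >= 1/2. *)
Lemma isO_expR_sub1_subid : isO 2 (fun a v => expR v - 1 - v).
Proof.
exists 2 => // a v a0 a1 v0 v1.
have v_le : expR v * (1 - v) <= 1.
  have := expR_ge1Dx (- v); rewrite -(ler_pM2l (expR_gt0 v)) -expRD subrr expR0.
  by [].
have w1 := expR_ge1Dx v.
have lev : expR v - 1 - v <= 2 * v ^+ 2.
  have h : (expR v - 1 - v) * (1 - v) <= v ^+ 2 by lra.
  nra.
rewrite ger0_norm; last by lra.
nra.
Qed.

Lemma isO_expR_sub1 : isO 1 (fun a v => expR v - 1).
Proof.
have -> : (fun _ v => expR v - 1) = (fun (_ : R) v => (expR v - 1 - v) + v).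
  by apply/funext => a; apply/funext => v; ring.
by apply: isOD isO_snd; apply: (@isO_weaken 1 1); exact: isO_expR_sub1_subid.
Qed.

Lemma isO_monomial i j f : isO 0 f ->
  isO (i + j) (fun a v => (expR v - 1) ^+ i * a ^+ j * f a v).
Proof.
move=> Of; rewrite -[(i + j)%N]addn0; apply: isOM Of; apply: isOM.
  by rewrite -[X in isO X]muln1; apply: isOX; exact: isO_expR_sub1.
by rewrite -[X in isO X]muln1; apply: isOX; exact: isO_fst.
Qed.

(** Polynomials in a and exp v - 1 are bounded on the region; the lemmas below
let [bounded] check this by structural recursion. *)
Lemma isO0M f g : isO 0 f -> isO 0 g -> isO 0 (fun a v => f a v * g a v).
Proof. exact: isOM. Qed.

Lemma isO0X n f : isO 0 f -> isO 0 (fun a v => f a v ^+ n).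
Proof. by move=> Of; rewrite -(muln0 n); exact: isOX. Qed.

Lemma isO0_fst : isO 0 (fun a v => a).
Proof. by apply: (@isO_weaken 0 1); exact: isO_fst. Qed.

Lemma isO0_expR_sub1 : isO 0 (fun a v => expR v - 1).
Proof. by apply: (@isO_weaken 0 1); exact: isO_expR_sub1. Qed.

(** E[I^2], E[I^3], E[I^4] as functions of a = 1 / (1 + r) and v. *)
Definition mom2 a v := expR v * (1 + 2 * a - a ^+ 2).
Definition mom3 a v := expR v ^+ 3 * (1 + 6 * a + 3 * a ^+ 2 - 4 * a ^+ 3).
Definition mom4 a v :=
  expR v ^+ 6 * (1 + 12 * a + 30 * a ^+ 2 - 4 * a ^+ 3 - 15 * a ^+ 4).
(** Central moments, using that the mean is 1. *)
Definition cmom3 a v := mom3 a v - 3 * mom2 a v + 2.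
Definition cmom4 a v := mom4 a v - 4 * mom3 a v + 6 * mom2 a v - 3.

Ltac bounded := repeat first
  [ exact: isO0_fst | exact: isO0_expR_sub1 | exact: isO_cst
  | apply: isOD | apply: isON | apply: isO0M | apply: isO0X ].

(** In each expansion below the first summand is the error made by replacing
exp v - 1 by v in the leading part; the others collect the monomials
(exp v - 1)^i a^j of higher total degree, grouped so that each is a monomial of
exactly the claimed order times a bounded polynomial. *)
Lemma isO_variance : isO 2 (fun a v => mom2 a v - 1 - (v + 2 * a)).
Proof.
have -> : (fun a v => mom2 a v - 1 - (v + 2 * a)) = (fun a v =>
    (expR v - 1 - v) + ((expR v - 1) ^+ 0 * a ^+ 2 * -1
      + (expR v - 1) ^+ 1 * a ^+ 1 * (2 - a))).
  by apply/funext => a; apply/funext => v; rewrite /mom2; ring.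
apply: isOD; first exact: isO_expR_sub1_subid.
apply: isOD; first by apply: (isO_monomial 0 2); bounded.
by apply: (isO_monomial 1 1); bounded.
Qed.

Lemma isO_cmom3 :
  isO 3 (fun a v => cmom3 a v - (3 * (v + 2 * a) ^+ 2 - 6 * a ^+ 2)).
Proof.
have -> : (fun a v => cmom3 a v - (3 * (v + 2 * a) ^+ 2 - 6 * a ^+ 2)) =
    (fun a v => (expR v - 1 - v) * (3 * ((expR v - 1) + v + (a + a + a + a)))
      + ((expR v - 1) ^+ 0 * a ^+ 3 * -4
      + ((expR v - 1) ^+ 1 * a ^+ 2 * (12 - 12 * a)
      + ((expR v - 1) ^+ 2 * a ^+ 1 * (18 + 9 * a - 12 * a ^+ 2)
      + (expR v - 1) ^+ 3 * a ^+ 0 * (1 + 6 * a + 3 * a ^+ 2 - 4 * a ^+ 3))))).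
  by apply/funext => a; apply/funext => v; rewrite /cmom3 /mom2 /mom3; ring.
apply: isOD.
  apply: (@isOM 2 1); first exact: isO_expR_sub1_subid.
  apply: (@isOM 0 1); first exact: isO_cst.
  apply: isOD; first exact: isOD isO_expR_sub1 isO_snd.
  by do 3!(apply: isOD isO_fst); exact: isO_fst.
apply: isOD; first by apply: (isO_monomial 0 3); bounded.
apply: isOD; first by apply: (isO_monomial 1 2); bounded.
apply: isOD; first by apply: (isO_monomial 2 1); bounded.
by apply: (isO_monomial 3 0); bounded.
Qed.

(** The fourth cumulant: its quadratic part cancels. *)
Lemma isO_cum4 :
  isO 4 (fun a v => cmom4 a v - 3 * (mom2 a v - 1) ^+ 2 -
    (16 * (v + 2 * a) ^+ 3 - 72 * (v + 2 * a) * a ^+ 2 + 40 * a ^+ 3)).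
Proof.
have -> : (fun a v => cmom4 a v - 3 * (mom2 a v - 1) ^+ 2 -
    (16 * (v + 2 * a) ^+ 3 - 72 * (v + 2 * a) * a ^+ 2 + 40 * a ^+ 3)) =
    (fun a v => (expR v - 1 - v) *
        (16 * ((expR v - 1 + (a + a)) ^+ 2 + (expR v - 1 + (a + a)) * (v + (a + a))
               + (v + (a + a)) ^+ 2) - 72 * a ^+ 2)
      + ((expR v - 1) ^+ 0 * a ^+ 4 * -18
      + ((expR v - 1) ^+ 1 * a ^+ 3 * (48 - 96 * a)
      + ((expR v - 1) ^+ 2 * a ^+ 2 * (408 - 228 * a ^+ 2)
      + ((expR v - 1) ^+ 3 * a ^+ 1 * (216 + 588 * a - 64 * a ^+ 2 - 300 * a ^+ 3)
      + (expR v - 1) ^+ 4 * a ^+ 0 *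
        (15 + 180 * a + 450 * a ^+ 2 - 60 * a ^+ 3 - 225 * a ^+ 4
         + (expR v - 1) * (6 + 72 * a + 180 * a ^+ 2 - 24 * a ^+ 3 - 90 * a ^+ 4)
         + (expR v - 1) ^+ 2 *
           (1 + 12 * a + 30 * a ^+ 2 - 4 * a ^+ 3 - 15 * a ^+ 4))))))).
  by apply/funext => a; apply/funext => v; rewrite /cmom4 /mom2 /mom3 /mom4; ring.
have O2a : isO 1 (fun a v => a + a) by apply: isOD; exact: isO_fst.
have Ou : isO 1 (fun a v => expR v - 1 + (a + a)) by exact: isOD isO_expR_sub1 O2a.
have Ov : isO 1 (fun a v => v + (a + a)) by exact: isOD isO_snd O2a.
apply: isOD.
  apply: (@isOM 2 2); first exact: isO_expR_sub1_subid.
  apply: isOD.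
    apply: (@isOM 0 2); first exact: isO_cst.
    apply: isOD; last by apply: (@isOX 1 2).
    by apply: isOD; [exact: (@isOX 1 2)|exact: (@isOM 1 1)].
  apply: isON; apply: (@isOM 0 2); first exact: isO_cst.
  by apply: (@isOX 1 2); exact: isO_fst.
apply: isOD; first by apply: (isO_monomial 0 4); bounded.
apply: isOD; first by apply: (isO_monomial 1 3); bounded.
apply: isOD; first by apply: (isO_monomial 2 2); bounded.
apply: isOD; first by apply: (isO_monomial 3 1); bounded.
by apply: (isO_monomial 4 0); bounded.
Qed.

End order_of_magnitude.

(** * Expansion of the standardized quantities *)

Section quotients.
Variable R : realType.
Implicit Types a v : R.

(** exp v - 1 >= v and 2 a - a^2 >= a, so the variance is at least v + a. *)
Lemma variance_ge a v : 0 < a -> a <= 1 -> 0 < v ->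
  (v + 2 * a) / 2 <= mom2 a v - 1.
Proof.
move=> a0 a1 v0; have w1 := expR_ge1Dx v; rewrite /mom2.
have a2 : 0 <= 2 * a - a ^+ 2 - a by nra.
nra.
Qed.

Lemma isO_variance_id : isO 1 (fun a v => mom2 a v - 1).
Proof.
have -> : (fun a v => mom2 a v - 1) =
    (fun a v => mom2 a v - 1 - (v + 2 * a) + (v + (a + a))).
  by apply/funext => a; apply/funext => v; ring.
apply: isOD; first by apply: (@isO_weaken _ 1 1); exact: isO_variance.
by apply: isOD; [exact: isO_snd|apply: isOD; exact: isO_fst].
Qed.

Lemma isO_V0 : isO 1 (fun a v => v + 2 * a).
Proof.
apply: isOD; first exact: isO_snd.
by apply: (@isOM _ 0 1); [exact: isO_cst|exact: isO_fst].
Qed.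

Lemma isO_variance_sqr : isO 3 (fun a v => (mom2 a v - 1) ^+ 2 - (v + 2 * a) ^+ 2).
Proof.
have -> : (fun a v => (mom2 a v - 1) ^+ 2 - (v + 2 * a) ^+ 2) = (fun a v =>
    (mom2 a v - 1 - (v + 2 * a)) * (mom2 a v - 1 + (v + 2 * a))).
  by apply/funext => a; apply/funext => v; ring.
apply: (@isOM _ 2 1); first exact: isO_variance.
by apply: isOD; [exact: isO_variance_id|exact: isO_V0].
Qed.

Lemma isO_variance_cube : isO 4 (fun a v => (mom2 a v - 1) ^+ 3 - (v + 2 * a) ^+ 3).
Proof.
have -> : (fun a v => (mom2 a v - 1) ^+ 3 - (v + 2 * a) ^+ 3) = (fun a v =>
    (mom2 a v - 1 - (v + 2 * a)) *
    ((mom2 a v - 1) ^+ 2 + (mom2 a v - 1) * (v + 2 * a) + (v + 2 * a) ^+ 2)).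
  by apply/funext => a; apply/funext => v; ring.
apply: (@isOM _ 2 2); first exact: isO_variance.
apply: isOD; last by apply: (@isOX _ 1 2); exact: isO_V0.
apply: isOD; first by apply: (@isOX _ 1 2); exact: isO_variance_id.
by apply: (@isOM _ 1 1); [exact: isO_variance_id|exact: isO_V0].
Qed.

(** With y = sqrt V and t = sqrt s the difference is
(c - q) / t^3 + q (y^6 - t^6) / (t^3 y^3 (y^3 + t^3)), and t >= y / 2. Passing
to sixth powers turns the difference of square roots into one of cubes of the
variances. *)
Lemma ler_div_sqrt3 (V s c q K L : R) : 0 < V -> V / 2 <= s ->
  `|c - q| <= K * V ^+ 3 -> `|q| <= 3 * V ^+ 2 ->
  `|s ^+ 3 - V ^+ 3| <= L * V ^+ 4 ->
  `|c / Num.sqrt s ^+ 3 - q / Num.sqrt V ^+ 3| <= (8 * K + 24 * L) * Num.sqrt V ^+ 3.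
Proof.
move=> V0 Vs cq qV sV.
have s0 : 0 < s by lra.
set t := Num.sqrt s; set y := Num.sqrt V.
have t0 : 0 < t by rewrite sqrtr_gt0.
have y0 : 0 < y by rewrite sqrtr_gt0.
have tt : t ^+ 2 = s by rewrite sqr_sqrtr ?ltW.
have yy : y ^+ 2 = V by rewrite sqr_sqrtr ?ltW.
rewrite -tt -yy -!exprM in Vs cq qV sV.
have yt : y / 2 <= t by nra.
have y30 : 0 < y ^+ 3 by rewrite exprn_gt0.
have t30 : 0 < t ^+ 3 by rewrite exprn_gt0.
have yt3 : y ^+ 3 / 8 <= t ^+ 3.
  have -> : y ^+ 3 / 8 = (y / 2) ^+ 3 by field.
  have y20 : 0 <= y / 2 by rewrite divr_ge0 ?ltW.
  by rewrite lerXn2r ?nnegrE ?(ltW t0).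
have -> : c / t ^+ 3 - q / y ^+ 3 =
    (c - q) / t ^+ 3 +
    q * (y ^+ 6 - t ^+ 6) / (t ^+ 3 * y ^+ 3 * (y ^+ 3 + t ^+ 3)).
  by field; rewrite !gt_eqF//= addr_gt0.
have first_le : `|(c - q) / t ^+ 3| <= 8 * K * y ^+ 3.
  rewrite normrM normfV (gtr0_norm t30) ler_pdivrMr//.
  apply: (le_trans cq).
  have K0 : 0 <= K by rewrite -(pmulr_lge0 _ (exprn_gt0 6 y0)) (le_trans _ cq).
  have -> : K * y ^+ 6 = 8 * K * y ^+ 3 * (y ^+ 3 / 8) by field.
  apply: ler_wpM2l => //.
  by apply: mulr_ge0; [apply: mulr_ge0|exact: ltW].
have second_le : `|q * (y ^+ 6 - t ^+ 6) / (t ^+ 3 * y ^+ 3 * (y ^+ 3 + t ^+ 3))|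
    <= 24 * L * y ^+ 3.
  have den0 : 0 < t ^+ 3 * y ^+ 3 * (y ^+ 3 + t ^+ 3) by rewrite !mulr_gt0 ?addr_gt0.
  rewrite normrM normfV (gtr0_norm den0) ler_pdivrMr// normrM distrC.
  apply: (le_trans (ler_pM _ _ qV sV)) => //.
  have L0 : 0 <= L by rewrite -(pmulr_lge0 _ (exprn_gt0 8 y0)) (le_trans _ sV).
  have -> : 3 * y ^+ 4 * (L * y ^+ 8) =
      24 * L * y ^+ 3 * (y ^+ 3 / 8 * y ^+ 3 * y ^+ 3).
    by field.
  apply: ler_wpM2l; first by apply: mulr_ge0; [apply: mulr_ge0|exact: ltW].
  apply: ler_pM.
  - by apply: mulr_ge0; [apply: divr_ge0|]; exact: ltW.
  - exact: ltW.
  - by rewrite ler_pM2r.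
  - by rewrite lerDl ltW.
by rewrite (le_trans (ler_normD _ _))// [leRHS]mulrDl lerD.
Qed.

Lemma ler_div_sqr (V s c q K L M : R) : 0 < V -> V / 2 <= s ->
  `|c - q| <= K * V ^+ 4 -> `|q| <= M * V ^+ 3 ->
  `|s ^+ 2 - V ^+ 2| <= L * V ^+ 3 ->
  `|c / s ^+ 2 - q / V ^+ 2| <= (4 * K + 4 * (M * L)) * V ^+ 2.
Proof.
move=> V0 Vs cq qV sV.
have s0 : 0 < s by lra.
have s20 : 0 < s ^+ 2 by rewrite exprn_gt0.
have V20 : 0 < V ^+ 2 by rewrite exprn_gt0.
have Vs2 : V ^+ 2 / 4 <= s ^+ 2 by nra.
have -> : c / s ^+ 2 - q / V ^+ 2 =
    (c - q) / s ^+ 2 + q * (V ^+ 2 - s ^+ 2) / (s ^+ 2 * V ^+ 2).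
  by field; rewrite !gt_eqF.
have K0 : 0 <= K by rewrite -(pmulr_lge0 _ (exprn_gt0 4 V0)) (le_trans _ cq).
have L0 : 0 <= L by rewrite -(pmulr_lge0 _ (exprn_gt0 3 V0)) (le_trans _ sV).
have M0 : 0 <= M by rewrite -(pmulr_lge0 _ (exprn_gt0 3 V0)) (le_trans _ qV).
have first_le : `|(c - q) / s ^+ 2| <= 4 * K * V ^+ 2.
  rewrite normrM normfV (gtr0_norm s20) ler_pdivrMr// (le_trans cq)//.
  have -> : K * V ^+ 4 = 4 * K * V ^+ 2 * (V ^+ 2 / 4) by field.
  apply: ler_wpM2l => //.
  by apply: mulr_ge0; [apply: mulr_ge0|exact: ltW].
have second_le : `|q * (V ^+ 2 - s ^+ 2) / (s ^+ 2 * V ^+ 2)|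
    <= 4 * (M * L) * V ^+ 2.
  have den0 : 0 < s ^+ 2 * V ^+ 2 by rewrite mulr_gt0.
  rewrite normrM normfV (gtr0_norm den0) ler_pdivrMr// normrM distrC.
  apply: (le_trans (ler_pM _ _ qV sV)) => //.
  have -> : M * V ^+ 3 * (L * V ^+ 3) = 4 * (M * L) * V ^+ 2 * (V ^+ 2 / 4 * V ^+ 2).
    by field.
  have ML0 : 0 <= M * L by exact: mulr_ge0.
  apply: ler_wpM2l; first by apply: mulr_ge0; [apply: mulr_ge0|exact: ltW].
  by rewrite ler_pM2r.
by rewrite (le_trans (ler_normD _ _))// [leRHS]mulrDl lerD.
Qed.

Lemma skewness_expansion : exists2 C, 0 < C & forall a v,
  0 < a -> a <= 1 -> 0 < v -> v <= 1 / 2 ->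
  `|cmom3 a v / Num.sqrt (mom2 a v - 1) ^+ 3 -
    3 * Num.sqrt (v + 2 * a) * (1 - 2 * (a / (v + 2 * a)) ^+ 2)|
  <= C * Num.sqrt (v + 2 * a) ^+ 3.
Proof.
have [K K0 cmom3K] := isO_cmom3 R; have [L L0 varL] := isO_variance_cube.
exists (8 * K + 24 * L + 1) => [|a v a0 a1 v0 v1]; first by lra.
set V := v + 2 * a.
have V0 : 0 < V by rewrite /V; lra.
have y0 : 0 < Num.sqrt V by rewrite sqrtr_gt0.
have -> : 3 * Num.sqrt V * (1 - 2 * (a / V) ^+ 2) =
    (3 * V ^+ 2 - 6 * a ^+ 2) / Num.sqrt V ^+ 3.
  have := sqr_sqrtr (ltW V0); move: y0; set y := Num.sqrt V => y0 <-.
  by field; rewrite gt_eqF.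
apply: (@le_trans _ _ ((8 * K + 24 * L) * Num.sqrt V ^+ 3)); last first.
  by rewrite ler_wpM2r ?exprn_ge0 ?ltW//; lra.
apply: ler_div_sqrt3 => //.
- exact: variance_ge.
- exact: cmom3K.
- (* a <= V / 2 makes 3 V^2 - 6 a^2 nonnegative *)
  rewrite ger0_norm; rewrite /V; nra.
- exact: varL.
Qed.

Lemma kurtosis_expansion : exists2 C, 0 < C & forall a v,
  0 < a -> a <= 1 -> 0 < v -> v <= 1 / 2 ->
  `|cmom4 a v / (mom2 a v - 1) ^+ 2 - 3 -
    8 * (v + 2 * a) * (2 - 9 * (a / (v + 2 * a)) ^+ 2 + 5 * (a / (v + 2 * a)) ^+ 3)|
  <= C * (v + 2 * a) ^+ 2.
Proof.
have [K K0 cumK] := isO_cum4 R; have [L L0 varL] := isO_variance_sqr.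
have [M M0 leadM] : isO 3 (fun a v =>
    16 * (v + 2 * a) ^+ 3 - 72 * (v + 2 * a) * a ^+ 2 + 40 * a ^+ 3).
  apply: isOD; last first.
    by apply: (@isOM _ 0 3); [exact: isO_cst|apply: (@isOX _ 1 3); exact: isO_fst].
  apply: isOD.
    by apply: (@isOM _ 0 3); [exact: isO_cst|apply: (@isOX _ 1 3); exact: isO_V0].
  apply: isON; apply: (@isOM _ 1 2); last by apply: (@isOX _ 1 2); exact: isO_fst.
  by apply: (@isOM _ 0 1); [exact: isO_cst|exact: isO_V0].
have ML0 : 0 <= M * L by exact: mulr_ge0.
exists (4 * K + 4 * (M * L) + 1) => [|a v a0 a1 v0 v1]; first by lra.
set V := v + 2 * a; set s := mom2 a v - 1.
have V0 : 0 < V by rewrite /V; lra.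
have Vs : V / 2 <= s by exact: variance_ge.
have s0 : 0 < s by lra.
have -> : cmom4 a v / s ^+ 2 - 3 - 8 * V * (2 - 9 * (a / V) ^+ 2 + 5 * (a / V) ^+ 3) =
    (cmom4 a v - 3 * s ^+ 2) / s ^+ 2 -
    (16 * V ^+ 3 - 72 * V * a ^+ 2 + 40 * a ^+ 3) / V ^+ 2.
  by field; rewrite !gt_eqF.
apply: (@le_trans _ _ ((4 * K + 4 * (M * L)) * V ^+ 2)); last first.
  by rewrite ler_wpM2r ?exprn_ge0 ?ltW//; lra.
by apply: ler_div_sqr; [|exact: Vs|exact: cumK|exact: leadM|exact: varL].
Qed.

End quotients.

(** * Skewness and kurtosis of the random variable *)

Section moments_values.
Variables (R : realType) (r v : R).
Hypothesis r0 : 0 < r.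
Let a := 1 / (1 + r).
Let r1 : 1 + r != 0. Proof. by rewrite gt_eqF// addr_gt0. Qed.

Lemma LR_moment0 : LR_moment r v 0 = 1.
Proof.
by rewrite /LR_moment !mul0r expR0 big_ord1 fact0 bin0 expr0; field.
Qed.

Lemma LR_moment1 : LR_moment r v 1 = 1.
Proof.
rewrite /LR_moment subrr mulr0 !mul0r expR0 !big_ord_recr big_ord0/=.
by rewrite !binE/= !factS fact0/=; field.
Qed.

Lemma LR_moment2 : LR_moment r v 2 = mom2 a v.
Proof.
rewrite /LR_moment /mom2 !big_ord_recr big_ord0/= !binE/= !factS fact0/=.
have -> : 2%:R * (2%:R - 1) * v / 2 = v by field.
by rewrite /a; field.
Qed.

Lemma LR_moment3 : LR_moment r v 3 = mom3 a v.
Proof.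
rewrite /LR_moment /mom3 !big_ord_recr big_ord0/= !binE/= !factS fact0/=.
have -> : 3%:R * (3%:R - 1) * v / 2 = 3%:R * v by field.
by rewrite expRM_natl /a; field.
Qed.

Lemma LR_moment4 : LR_moment r v 4 = mom4 a v.
Proof.
rewrite /LR_moment /mom4 !big_ord_recr big_ord0/= !binE/= !factS fact0/=.
have -> : 4%:R * (4%:R - 1) * v / 2 = 6%:R * v by field.
by rewrite expRM_natl /a; field.
Qed.

End moments_values.

Section standardized_moments.
Variables (R : realType) (d : measure_display) (T : measurableType d)
  (P : probability T R) (I : {RV P >-> R}) (r v : R).
Hypotheses (r0 : 0 < r) (v0 : 0 < v) (I_LR : is_lognormal_rician r v I).
Let a := 1 / (1 + r).

Lemma LR_mean : mean P I = 1.
Proof.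
have [_] := LR_raw_moment 1 r0 v0 I_LR.
by rewrite LR_moment1// /mean => ->.
Qed.

Let expectation_poly (s : seq R) :=
  expectation_lincomb_expn (fun i => s`_i) (size s)
    (fun k => LR_raw_moment k r0 v0 I_LR).

Lemma LR_std_dev : std_dev P I = Num.sqrt (mom2 a v - 1).
Proof.
rewrite /std_dev /variance covariance.unlock -/(mean P I) LR_mean.
have [_] := expectation_poly [:: 1; -2; 1].
rewrite !big_ord_recr big_ord0/= LR_moment0// LR_moment1// LR_moment2//.
have -> : (fun w => (\sum_(i < 3) [:: 1; -2; 1]`_i * I w ^+ i)) =
    ((I \- cst 1) * (I \- cst 1)).
  by apply/funext => w; rewrite !big_ord_recr big_ord0/= fctE/=; ring.
by move=> ->/=; congr Num.sqrt; ring.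
Qed.

Lemma LR_skewness :
  (skewness P I = (cmom3 a v / Num.sqrt (mom2 a v - 1) ^+ 3)%:E)%E.
Proof.
rewrite /skewness /standardized LR_mean LR_std_dev.
set t := Num.sqrt _.
have [_] := expectation_poly [:: - t ^- 3; 3 * t ^- 3; -3 * t ^- 3; t ^- 3].
rewrite !big_ord_recr big_ord0/= LR_moment0// LR_moment1// LR_moment2// LR_moment3//.
rewrite -/a.
have -> : (fun w => (\sum_(i < 4) [:: - t ^- 3; 3 * t ^- 3; -3 * t ^- 3; t ^- 3]`_i
    * I w ^+ i)) = (fun w => ((I w - 1) / t) ^+ 3).
  by apply/funext => w; rewrite !big_ord_recr big_ord0/= exprMn exprVn; ring.
by move=> ->; congr EFin; rewrite /cmom3; ring.
Qed.

Lemma LR_excess_kurtosis : 0 < mom2 a v - 1 ->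
  (excess_kurtosis P I = (cmom4 a v / (mom2 a v - 1) ^+ 2 - 3)%:E)%E.
Proof.
move=> s0; rewrite /excess_kurtosis /standardized LR_mean LR_std_dev.
have -> : (mom2 a v - 1) ^+ 2 = Num.sqrt (mom2 a v - 1) ^+ 4.
  by rewrite (exprM _ 2 2) sqr_sqrtr ?ltW.
set t := Num.sqrt _.
pose c := [:: t ^- 4; -4 * t ^- 4; 6 * t ^- 4; -4 * t ^- 4; t ^- 4].
have [_] := expectation_poly c.
rewrite !big_ord_recr big_ord0/= LR_moment0// LR_moment1// LR_moment2//.
rewrite LR_moment3// LR_moment4//.
rewrite -/a.
have -> : (fun w => (\sum_(i < 5) c`_i * I w ^+ i)) = (fun w => ((I w - 1) / t) ^+ 4).
  by apply/funext => w; rewrite !big_ord_recr big_ord0/= exprMn exprVn; ring.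
by move=> ->; rewrite -EFinB; congr EFin; rewrite /cmom4; ring.
Qed.

End standardized_moments.

(** rho = 1 / ((1 + r) v + 2). *)
Lemma rho_bounds (R : realType) (r v : R) : 0 < r -> 0 < v ->
  0 < rho r v /\ rho r v < 1 / 2.
Proof.
move=> r0 v0.
have r1 : 0 < 1 + r by rewrite addr_gt0.
have den : (1 + r) * V0 r v = (1 + r) * v + 2 by rewrite /V0; field; rewrite gt_eqF.
have rv : 0 < (1 + r) * v by rewrite mulr_gt0.
rewrite /rho den; split; first by rewrite divr_gt0//; lra.
by rewrite ltr_pdivrMr; lra.
Qed.

Theorem proposition2 (R : realType) :
  (forall r v : R, 0 < r -> 0 < v -> 0 < rho r v /\ rho r v < 1 / 2) /\
  (exists C r0 s0 : R, [/\ 0 < C, 0 < r0, 0 < s0 &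
    forall (r v : R), r0 <= r -> 0 < v -> v <= s0 ->
    forall (d : measure_display) (T : measurableType d) (P : probability T R)
      (I : {RV P >-> R}), is_lognormal_rician r v I ->
      (`| skewness P I
          - (3 * Num.sqrt (V0 r v) * (1 - 2 * (rho r v) ^+ 2))%R%:E |
         <= (C * (V0 r v) `^ (3 / 2))%R%:E)%E /\
      (`| excess_kurtosis P I
          - (8 * V0 r v * (2 - 9 * (rho r v) ^+ 2 + 5 * (rho r v) ^+ 3))%R%:E |
         <= (C * (V0 r v) ^+ 2)%R%:E)%E]).
Proof.
split; first exact: rho_bounds.
have [C C0 skewC] := skewness_expansion R.
have [D D0 kurtD] := kurtosis_expansion R.
exists (C + D), 1, (1 / 2); split; [exact: addr_gt0|by []|by []|].
move=> r v r_ge1 v0 v_le d T P I I_LR.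
have r0 : 0 < r by exact: lt_le_trans r_ge1.
have r1 : 0 < 1 + r by rewrite addr_gt0.
pose a := 1 / (1 + r).
have a0 : 0 < a by rewrite divr_gt0.
have a1 : a <= 1 by rewrite ler_pdivrMr//; lra.
have VE : V0 r v = v + 2 * a by rewrite /V0 /a mul1r.
have V_gt0 : 0 < v + 2 * a by lra.
have rhoE : rho r v = a / (v + 2 * a).
  by rewrite /rho VE invfM mulrA.
have s0 : 0 < mom2 a v - 1.
  by rewrite (lt_le_trans _ (variance_ge a0 a1 v0))// divr_gt0.
rewrite (LR_skewness r0 v0 I_LR) (LR_excess_kurtosis r0 v0 I_LR s0) -/a rhoE VE.
have V32 : (v + 2 * a) `^ (3 / 2) = Num.sqrt (v + 2 * a) ^+ 3.
  have -> : 3 / 2 = 2^-1 * 3 :> R by rewrite mulrC.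
  by rewrite powRrM powR12_sqrt ?(ltW V_gt0)// powR_mulrn ?sqrtr_ge0.
rewrite V32 -!EFinB !abse_EFin !lee_fin; split.
  apply: (le_trans (skewC _ _ a0 a1 v0 v_le)).
  by rewrite ler_wpM2r ?exprn_ge0 ?sqrtr_ge0// lerDl ltW.
apply: (le_trans (kurtD _ _ a0 a1 v0 v_le)).
by rewrite ler_wpM2r ?exprn_ge0 ?(ltW V_gt0)// lerDr ltW.
Qed.
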